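(* For all $t>0$, $$1<I_0(t)<\cosh t,$$ or equivalently, the double inequality $$\sqrt{ab}<TQ(a,b)<\frac{a+b}{2}$$ holds for all $a,b>0$ with $a\ne b$.
   Context: $I_0(t)=\sum_{n=0}^{\infty}\frac{t^{2n}}{2^{2n}(n!)^2}$ denotes the modified Bessel function of the first kind of order $0$. For $a,b>0$, $TQ(a,b)=\frac2\pi\int_0^{\pi/2}a^{\cos^2\theta}b^{\sin^2\theta}\,d\theta$ is the Toader-Qi mean. *)

(* Defs.v *)
From Stdlib Require Import Factorial Reals.
From Coquelicot Require Import Coquelicot.
Open Scope R_scope.

(* The modified Bessel function of the first kind of order 0. [Series] is
   total; here the series converges for every real [t]. *)
Definition I0 (t : R) : R :=
  Series (fun n : nat => t ^ (2 * n) / (2 ^ (2 * n) * INR (fact n) ^ 2)).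

(* The Toader-Qi mean, used for [a, b > 0] only, where [Rpower] is the genuine
   real power and the integrand is continuous (hence integrable). *)
Definition TQ (a b : R) : R :=
  2 / PI *
  RInt (fun theta : R => Rpower a (cos theta ^ 2) * Rpower b (sin theta ^ 2))
       0 (PI / 2).

(* Main.v *)
Require Import Defs.
From Stdlib Require Import Factorial Reals Lia Lra.
From Coquelicot Require Import Coquelicot.
Open Scope R_scope.

(** The two double inequalities are proved independently of each other.

    For [I0], compare power series term by term: the even part of the
    exponential series gives [cosh t = sum t^(2n) / (2n)!], and
    [(2n)! <= 4^n (n!)^2], strictly for [n = 1] ([fact_double_le],
    [cosh_series]). The lower bound [1] is the term of index [0] of [I0 t], whose
    other terms are positive.

    For the Toader-Qi mean, put [L = (ln a - ln b) / 2]. Since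
    [cos^2 - sin^2 = cos (2 theta)], the integrand is
    [sqrt (a b) * exp (L cos (2 theta))] ([integrand_exp]). Convexity of [exp]
    places [exp (L u)] on [[-1, 1]] above its tangent [1 + L u] at [u = 0] and
    below its chord [cosh L + u sinh L] ([exp_lt_chord]). With
    [u = cos (2 theta)] the linear terms integrate to [0] over [[0, pi/2]]
    ([RInt_affine_cos]), so only the values at [u = 0] survive, namely
    [sqrt (a b)] and [sqrt (a b) * cosh L = (a + b) / 2]. *)

(** * Series *)

Lemma Series_zero : Series (fun _ => 0) = 0.
Proof.
  rewrite (Series_ext _ (fun n => 0 * (fun _ => 0) n)).
  - rewrite Series_scal_l; ring.
  - intros n; ring.
Qed.

Lemma ex_series_le_pos (a b : nat -> R) :
  (forall n, 0 <= a n <= b n) -> ex_series b -> ex_series a.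
Proof.
  intros Hab.
  apply (ex_series_le (V := R_CompleteNormedModule) a b).
  intros n; change (Rabs (a n) <= b n).
  rewrite Rabs_pos_eq; apply Hab.
Qed.

Lemma Series_lt (k : nat) (a b : nat -> R) :
  (forall n, 0 <= a n <= b n) -> ex_series b -> a k < b k ->
  Series a < Series b.
Proof.
  revert a b; induction k as [|k IH]; intros a b Hab Hb Hk.
  all: pose proof (ex_series_le_pos a b Hab Hb) as Ha.
  all: rewrite (Series_incr_1 a Ha), (Series_incr_1 b Hb).
  all: pose proof (proj1 (ex_series_incr_1 b) Hb) as Hb'.
  - apply Rplus_lt_le_compat; [exact Hk|].
    apply Series_le; [|exact Hb'].
    intros n; apply Hab.
  - apply Rplus_le_lt_compat; [apply Hab|].
    apply IH; [|exact Hb'|exact Hk].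
    intros n; apply Hab.
Qed.

(** The central binomial coefficient is at most [4^n]: in passing from [n] to
    [n + 1], [(2n)!] gains the factor [(2n+1)(2n+2)] and [4^n (n!)^2] the
    larger factor [(2n+2)^2]. *)
Lemma fact_double_le (n : nat) :
  INR (fact (2 * n)) <= 2 ^ (2 * n) * INR (fact n) ^ 2.
Proof.
  induction n as [|n IH]; [simpl; lra|].
  replace (2 * S n)%nat with (S (S (2 * n))) by lia.
  rewrite !fact_simpl, !mult_INR, !S_INR, mult_INR.
  change (INR 2) with 2.
  simpl pow in *.
  pose proof (pos_INR n) as Hn.
  pose proof (pos_INR (fact (2 * n))) as Hf.
  set (F := INR (fact (2 * n))) in *.
  set (G := INR (fact n)) in *.
  set (P := 2 ^ (n + (n + 0))) in *.
  set (N := INR n) in *.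
  apply Rle_trans with ((2 * N + 2) ^ 2 * F); [nra|].
  replace (2 * (2 * P) * ((N + 1) * G * ((N + 1) * G * 1)))
    with ((2 * N + 2) ^ 2 * (P * (G * (G * 1)))) by ring.
  apply Rmult_le_compat_l; [nra|exact IH].
Qed.

(** Any subfamily of the exponential coefficients with indices [m n >= n] is
    dominated by the exponential series itself. *)
Lemma ex_pseries_inv_fact (m : nat -> nat) (x : R) :
  0 <= x -> (forall n, (n <= m n)%nat) ->
  ex_pseries (fun n => / INR (fact (m n))) x.
Proof.
  intros Hx Hm.
  apply (ex_series_le_pos _ (fun n => scal (pow_n x n) (/ INR (fact n)))).
  - intros n; rewrite pow_n_pow; unfold scal; simpl; unfold mult; simpl.
    assert (0 <= x ^ n) by (apply pow_le; exact Hx).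
    pose proof (INR_fact_lt_0 n). pose proof (INR_fact_lt_0 (m n)).
    assert (0 < / INR (fact (m n))) by (apply Rinv_0_lt_compat; assumption).
    split; [apply Rmult_le_pos; lra|].
    apply Rmult_le_compat_l; [assumption|].
    apply Rinv_le_contravar; [assumption|].
    apply le_INR, fact_le, Hm.
  - exists (exp x); apply is_exp_Reals.
Qed.

Lemma ex_cosh_series (t : R) :
  ex_series (fun n => t ^ (2 * n) / INR (fact (2 * n))).
Proof.
  apply (ex_series_ext
    (fun n => scal (pow_n (t ^ 2) n) (/ INR (fact (2 * n))))).
  - intros n; rewrite pow_n_pow, <- pow_mult; reflexivity.
  - apply (ex_pseries_inv_fact (fun n => (2 * n)%nat)); [nra|intros; lia].
Qed.

(** In [exp t + exp (- t)] the odd parts of the two exponential series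
    cancel. *)
Lemma cosh_series (t : R) :
  cosh t = Series (fun n => t ^ (2 * n) / INR (fact (2 * n))).
Proof.
  set (E := PSeries (fun n => / INR (fact (2 * n))) (t ^ 2)).
  set (O := PSeries (fun n => / INR (fact (2 * n + 1))) (t ^ 2)).
  assert (Hexp : forall x, x ^ 2 = t ^ 2 -> exp x = E + x * O).
  { intros x Hx.
    rewrite <- (is_pseries_unique _ _ _ (is_exp_Reals x)).
    unfold E, O; rewrite <- Hx.
    apply (PSeries_odd_even (fun n => / INR (fact n)));
      [apply (ex_pseries_inv_fact (fun n => (2 * n)%nat))
      |apply (ex_pseries_inv_fact (fun n => (2 * n + 1)%nat))];
      try (intros; lia); nra. }
  unfold cosh.
  rewrite (Hexp t) by reflexivity.
  rewrite (Hexp (- t)) by ring.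
  replace ((E + t * O + (E + - t * O)) / 2) with E by field.
  apply Series_ext; intros n.
  rewrite <- pow_mult; unfold Rdiv; ring.
Qed.

Lemma I0_term_bounds (t : R) (n : nat) :
  0 <= t ^ (2 * n) / (2 ^ (2 * n) * INR (fact n) ^ 2)
    <= t ^ (2 * n) / INR (fact (2 * n)).
Proof.
  assert (0 <= t ^ (2 * n)) by (rewrite pow_mult; apply pow_le; nra).
  pose proof (INR_fact_lt_0 (2 * n)).
  pose proof (fact_double_le n).
  assert (0 < / (2 ^ (2 * n) * INR (fact n) ^ 2))
    by (apply Rinv_0_lt_compat; lra).
  split.
  - apply Rmult_le_pos; lra.
  - apply Rmult_le_compat_l; [assumption|].
    apply Rinv_le_contravar; assumption.
Qed.

Lemma I0_lt_cosh (t : R) : 0 < t -> I0 t < cosh t.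
Proof.
  intros Ht; rewrite cosh_series; unfold I0.
  apply (Series_lt 1).
  - apply I0_term_bounds.
  - apply ex_cosh_series.
  - simpl; nra.
Qed.

Lemma one_lt_I0 (t : R) : 0 < t -> 1 < I0 t.
Proof.
  intros Ht; unfold I0.
  pose proof (ex_series_le_pos _ _ (I0_term_bounds t) (ex_cosh_series t))
    as Hex.
  rewrite (Series_incr_1 _ Hex).
  match goal with |- 1 < ?a0 + Series ?tail =>
    replace a0 with 1 by (simpl; field);
    enough (Series (fun _ => 0) < Series tail)
      by (rewrite Series_zero in *; lra)
  end.
  apply (Series_lt 0).
  - intros n; split; [lra|apply I0_term_bounds].
  - apply (proj1 (ex_series_incr_1 _) Hex).
  - simpl; nra.
Qed.

(** * The Toader-Qi mean *)

(** The exceptional point [c] accommodates a tangent line, which meets the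
    curve at the point of contact. *)
Lemma RInt_lt_except (f g : R -> R) (a c b : R) :
  a < c < b ->
  (forall x : R, continuous f x) -> (forall x : R, continuous g x) ->
  (forall x, a < x < b -> x <> c -> f x < g x) ->
  RInt f a b < RInt g a b.
Proof.
  intros Hc Hf Hg Hfg.
  assert (Hex : forall (h : R -> R) u v,
    (forall x : R, continuous h x) -> ex_RInt h u v)
    by (intros h u v Hh;
      apply (ex_RInt_continuous (V := R_CompleteNormedModule) h); intros; apply Hh).
  rewrite <- (RInt_Chasles f a c b), <- (RInt_Chasles g a c b)
    by (apply Hex; assumption).
  unfold plus; simpl.
  apply Rplus_lt_compat; apply RInt_lt; try lra; intros;
    try apply Hf; try apply Hg; apply Hfg; lra.
Qed.

(** Add the strict tangent inequalities of [exp] at [L u], taken at [L] and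
    [- L], with weights [(1 + u) / 2] and [(1 - u) / 2]; the slopes cancel. *)
Lemma exp_lt_chord (L u : R) :
  L <> 0 -> -1 < u < 1 -> exp (L * u) < cosh L + sinh L * u.
Proof.
  intros HL Hu.
  assert (Htan : forall y, y <> L * u ->
    exp (L * u) * (1 + (y - L * u)) < exp y).
  { intros y Hy.
    replace (exp y) with (exp (L * u) * exp (y - L * u))
      by (rewrite <- exp_plus; f_equal; ring).
    apply Rmult_lt_compat_l; [apply exp_pos|apply exp_ineq1; lra]. }
  assert (H1 : L <> L * u).
  { intros E; apply HL.
    apply (Rmult_eq_reg_r (1 - u)); [lra|lra]. }
  assert (H2 : - L <> L * u).
  { intros E; apply HL.
    apply (Rmult_eq_reg_r (1 + u)); [lra|lra]. }
  pose proof (Rmult_lt_compat_l ((1 + u) / 2) _ _ ltac:(lra) (Htan _ H1)) as K1.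
  pose proof (Rmult_lt_compat_l ((1 - u) / 2) _ _ ltac:(lra) (Htan _ H2)) as K2.
  unfold cosh, sinh.
  pose proof (Rplus_lt_compat _ _ _ _ K1 K2) as K.
  lra.
Qed.

Lemma RInt_affine_cos (p q : R) :
  RInt (fun x => p + q * cos (2 * x)) 0 (PI / 2) = p * (PI / 2).
Proof.
  apply is_RInt_unique.
  replace (p * (PI / 2)) with
    (minus (p * (PI / 2) + q / 2 * sin (2 * (PI / 2)))
           (p * 0 + q / 2 * sin (2 * 0))).
  - apply (is_RInt_derive (fun x => p * x + q / 2 * sin (2 * x))
      (fun x => p + q * cos (2 * x))).
    + intros x _; auto_derive; [trivial|field].
    + intros x _; apply (ex_derive_continuous (V := R_NormedModule)).
      auto_derive; trivial.
  - unfold minus, plus, opp; simpl.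
    replace (2 * (PI / 2)) with PI by field.
    rewrite !Rmult_0_r, sin_PI, sin_0; ring.
Qed.

Lemma integrand_exp (a b x : R) :
  0 < a -> 0 < b ->
  Rpower a (cos x ^ 2) * Rpower b (sin x ^ 2) =
  sqrt (a * b) * exp ((ln a - ln b) / 2 * cos (2 * x)).
Proof.
  intros Ha Hb.
  rewrite <- Rpower_sqrt by (apply Rmult_lt_0_compat; assumption).
  unfold Rpower; rewrite ln_mult by assumption.
  rewrite <- !exp_plus; f_equal.
  rewrite cos_2a.
  pose proof (sin2_cos2 x) as H; unfold Rsqr in H.
  replace (/ 2 * (ln a + ln b)) with
    (/ 2 * (ln a + ln b) * (sin x * sin x + cos x * cos x))
    by (rewrite H; ring).
  field.
Qed.

Lemma sqrt_mul_cosh (a b : R) :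
  0 < a -> 0 < b ->
  sqrt (a * b) * cosh ((ln a - ln b) / 2) = (a + b) / 2.
Proof.
  intros Ha Hb.
  rewrite <- Rpower_sqrt by (apply Rmult_lt_0_compat; assumption).
  unfold Rpower, cosh; rewrite ln_mult by assumption.
  unfold Rdiv at 1; rewrite <- Rmult_assoc, Rmult_plus_distr_l, <- !exp_plus.
  replace (/ 2 * (ln a + ln b) + (ln a - ln b) / 2) with (ln a) by field.
  replace (/ 2 * (ln a + ln b) + - ((ln a - ln b) / 2)) with (ln b) by field.
  rewrite !exp_ln by assumption; reflexivity.
Qed.

Lemma TQ_exp (a b : R) :
  0 < a -> 0 < b ->
  TQ a b = 2 / PI * RInt (fun x =>
    sqrt (a * b) * exp ((ln a - ln b) / 2 * cos (2 * x))) 0 (PI / 2).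
Proof.
  intros Ha Hb; unfold TQ; f_equal.
  apply RInt_ext; intros x _; apply integrand_exp; assumption.
Qed.

Lemma continuous_exp_cos (s L x : R) :
  continuous (fun x => s * exp (L * cos (2 * x))) x.
Proof.
  apply (ex_derive_continuous (V := R_NormedModule)).
  auto_derive; trivial.
Qed.

Lemma continuous_affine_cos (p q x : R) :
  continuous (fun x => p + q * cos (2 * x)) x.
Proof.
  apply (ex_derive_continuous (V := R_NormedModule)).
  auto_derive; trivial.
Qed.

Lemma half_ln_diff_neq0 (a b : R) :
  0 < a -> 0 < b -> a <> b -> (ln a - ln b) / 2 <> 0.
Proof.
  intros Ha Hb Hab H; apply Hab, ln_inv; try assumption; lra.
Qed.

Lemma sqrt_lt_TQ (a b : R) :
  0 < a -> 0 < b -> a <> b -> sqrt (a * b) < TQ a b.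
Proof.
  intros Ha Hb Hab.
  pose proof PI_RGT_0 as HPI.
  pose proof (half_ln_diff_neq0 a b Ha Hb Hab) as HL.
  rewrite TQ_exp by assumption.
  set (L := (ln a - ln b) / 2) in *.
  assert (Hs : 0 < sqrt (a * b))
    by (apply sqrt_lt_R0, Rmult_lt_0_compat; assumption).
  set (s := sqrt (a * b)) in *.
  replace s with (2 / PI * (s * (PI / 2))) at 1 by (field; lra).
  apply Rmult_lt_compat_l; [apply Rdiv_lt_0_compat; lra|].
  rewrite <- (RInt_affine_cos s (s * L)).
  (* [cos (2 x)] vanishes at [PI / 4], where the tangent touches. *)
  apply (RInt_lt_except _ _ _ (PI / 4)); [lra| | |].
  - intros x; apply continuous_affine_cos.
  - intros x; apply continuous_exp_cos.
  - intros x Hx Hx4.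
    assert (Hcos : cos (2 * x) <> 0).
    { destruct (Rlt_or_le x (PI / 4)) as [Hlt|Hge].
      - apply Rgt_not_eq, cos_gt_0; lra.
      - apply Rlt_not_eq, cos_lt_0; lra. }
    replace (s + s * L * cos (2 * x)) with (s * (1 + L * cos (2 * x))) by ring.
    apply Rmult_lt_compat_l; [exact Hs|].
    apply exp_ineq1, Rmult_integral_contrapositive_currified; assumption.
Qed.

Lemma TQ_lt_mean (a b : R) :
  0 < a -> 0 < b -> a <> b -> TQ a b < (a + b) / 2.
Proof.
  intros Ha Hb Hab.
  pose proof PI_RGT_0 as HPI.
  pose proof (half_ln_diff_neq0 a b Ha Hb Hab) as HL.
  rewrite TQ_exp, <- sqrt_mul_cosh by assumption.
  set (L := (ln a - ln b) / 2) in *.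
  assert (Hs : 0 < sqrt (a * b))
    by (apply sqrt_lt_R0, Rmult_lt_0_compat; assumption).
  set (s := sqrt (a * b)) in *.
  replace (s * cosh L) with (2 / PI * (s * cosh L * (PI / 2)))
    by (field; lra).
  apply Rmult_lt_compat_l; [apply Rdiv_lt_0_compat; lra|].
  rewrite <- (RInt_affine_cos (s * cosh L) (s * sinh L)).
  apply RInt_lt; [lra| | |].
  - intros x _; apply continuous_affine_cos.
  - intros x _; apply continuous_exp_cos.
  - intros x Hx.
    replace (s * cosh L + s * sinh L * cos (2 * x))
      with (s * (cosh L + sinh L * cos (2 * x))) by ring.
    apply Rmult_lt_compat_l; [exact Hs|].
    apply exp_lt_chord; [exact HL|].
    split; [rewrite <- cos_PI|rewrite <- cos_0];
      apply cos_decreasing_1; lra.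
Qed.

Theorem mainTheorem10 :
  (forall t : R, 0 < t -> 1 < I0 t /\ I0 t < cosh t) /\
  (forall a b : R, 0 < a -> 0 < b -> a <> b ->
     sqrt (a * b) < TQ a b /\ TQ a b < (a + b) / 2).
Proof.
  split.
  - intros t Ht; split; [apply one_lt_I0|apply I0_lt_cosh]; exact Ht.
  - intros a b Ha Hb Hab.
    split; [apply sqrt_lt_TQ|apply TQ_lt_mean]; assumption.
Qed.
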